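(* Let $G_A$ be an almost abelian Lie group of dimension $2n$ with Lie algebra $\mathfrak g_A=\mathbb Re_0\ltimes_A\mathfrak h$. (1) If $\mathrm{spec}(A)\subset\mathbb R$ and every eigenvalue of $A$ has geometric multiplicity $1$, then every left-invariant generalized complex structure on $G_A$ has type $k\le1$. (2) For $A$ of arbitrary Jordan type: for each real eigenvalue $\lambda$ of $A$, let its generalized eigenspace decompose into $s_\lambda$ real Jordan blocks of sizes $m_1^{(\lambda)}\ge\cdots\ge m_{s_\lambda}^{(\lambda)}$, and put $m_\lambda=\sum_i m_i^{(\lambda)}$. Then the type $k$ of any left-invariant generalized complex structure on $G_A$ satisfies $$k\le\min_\lambda\left(\sum_{j=1}^{\lfloor s_\lambda/2\rfloor}m_{2j}^{(\lambda)}+\left\lfloor\frac{2n-1-m_\lambda}{2}\right\rfloor+1\right),$$ the minimum being taken over the real eigenvalues $\lambda$ of $A$.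
   Context: Almost abelian Lie groups: $\mathfrak g_A=\mathbb Re_0\ltimes_A\mathfrak h$ is the real Lie algebra with abelian ideal $\mathfrak h\cong\mathbb R^{2n-1}$ of codimension one and bracket $[e_0,v]=Av$ for $v\in\mathfrak h$, where $A$ is the real $(2n-1)\times(2n-1)$ matrix of $\mathrm{ad}_{e_0}|_{\mathfrak h}$; $G_A$ is the simply connected Lie group with Lie algebra $\mathfrak g_A$. Left-invariant generalized complex structures: for a Lie group $G$ with Lie algebra $\mathfrak g$ of real dimension $2n$, give $\mathfrak g\oplus\mathfrak g^*$ the pairing $\langle X+\xi,Y+\eta\rangle=\frac12(\xi(Y)+\eta(X))$. A left-invariant generalized complex structure on $G$ is (equivalently) a linear map $\mathcal J$ of $\mathfrak g\oplus\mathfrak g^*$ with $\mathcal J^2=-\mathrm{Id}$, orthogonal for the pairing, whose $\mathbf i$-eigenspace $L\subset(\mathfrak g\oplus\mathfrak g^* )\otimes\mathbb C$ is closed under the Courant bracket on left-invariant sections, $[[X+\xi,Y+\eta]]=[X,Y]+\mathrm{ad}^*_X\eta-\mathrm{ad}^*_Y\xi$, with $(\mathrm{ad}^*_X\eta)(Y)=-\eta([X,Y])$ (extended $\mathbb C$-bilinearly). The space $L$ is the annihilator, for the Clifford action $(X+\xi)\cdot\rho=\iota_X\rho+\xi\wedge\rho$, of a unique complex line $K_L\subset\bigwedge^\bullet\mathfrak g^*\otimes\mathbb C$. Any generator $\rho$ of $K_L$ has the form $\rho=\exp(B+\mathbf i\omega)\wedge\Omega$ with $B,\omega\in\bigwedge^2\mathfrak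 g^*$ real and $\Omega=\theta_1\wedge\cdots\wedge\theta_k$ with linearly independent $\theta_i\in\mathfrak g^*\otimes\mathbb C$ ($\Omega$ a nonzero constant if $k=0$), and satisfies $\omega^{n-k}\wedge\Omega\wedge\overline\Omega\ne0$. The integer $k\in\{0,\dots,n\}$ is the type of $\mathcal J$. *)

(* Defs.v *)
From HB Require Import structures.
From mathcomp Require Import all_boot all_order all_algebra.
From mathcomp Require Import reals complex.

Set Implicit Arguments.
Unset Strict Implicit.
Unset Printing Implicit Defensive.

Import Order.TTheory GRing.Theory Num.Theory.

Local Open Scope ring_scope.
Local Open Scope complex_scope.

(* A real Lie algebra of dimension N is 'cV[R]_N with a
   bracket br; its dual is 'rV[R]_N, a covector xi taking the value xi *m X
   at X; gtan F N is g (+) g^*, over F = R or over F = R[i]. *)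
Notation gtan F N := ('cV[F]_N * 'rV[F]_N)%type.

Section AlmostAbelian.
Variables (F : fieldType) (d : nat) (A : 'M[F]_d).

(* Coordinate 0 is along e_0, the remaining ones are along the ideal h:
   [a e_0 + v, b e_0 + w] = A (a w - b v). *)
Definition almost_abelian_bracket (X Y : 'cV[F]_(1 + d)) : 'cV[F]_(1 + d) :=
  col_mx 0 (A *m ((usubmx X) 0 0 *: dsubmx Y - (usubmx Y) 0 0 *: dsubmx X)).

End AlmostAbelian.

Section JordanBlocks.
Variable F : fieldType.

Definition jordan_block (lam : F) (m : nat) : 'M[F]_m :=
  \matrix_(i, j) (lam *+ (i == j) + (j == i.+1 :> nat)%:R).

(* The generalized eigenspace of A for lam has a basis (the columns of V) in
   which A is block diagonal, with Jordan blocks of sizes m_1 >= ... >= m_s > 0;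
   m_i is nth 0 m i.-1.  MathComp's eigenspaces consist of row vectors, hence
   the transposes: the rows u of geigenspace A^T lam are those for which u^T is
   a generalized eigenvector of A, for the action v |-> A *m v. *)
Definition jordan_sizes (d : nat) (A : 'M[F]_d) (lam : F) (m : seq nat) : Prop :=
  [/\ sorted geq m, all (leq 1) m &
    exists V : 'M[F]_(d, \sum_(i < size m) nth 0%N m i),
      [/\ row_free V^T, (V^T :=: geigenspace A^T lam)%MS &
          A *m V = V *m \mxdiag_(i < size m) jordan_block lam (nth 0%N m i)]].

End JordanBlocks.

(* The exterior algebra of F^N: a form is given by its coefficients on the basis
   e^S = e^(i_1) /\ ... /\ e^(i_p), for S = {i_1 < ... < i_p}. *)
Notation ext F N := {ffun {set 'I_N} -> F^o}.

Section ExteriorAlgebra.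
Variables (F : fieldType) (N : nat).
Implicit Types (a b : ext F N) (S T : {set 'I_N}).

(* e^S /\ e^T = (-1) ^+ inversions S T *: e^(S :|: T) for disjoint S and T. *)
Definition inversions S T : nat :=
  #|[set p : 'I_N * 'I_N | [&& p.1 \in S, p.2 \in T & (p.2 < p.1)%N]]|.

Definition wedge a b : ext F N :=
  [ffun S : {set 'I_N} => \sum_(T in powerset S)
     (-1) ^+ inversions T (S :\: T) * a T * b (S :\: T)].

Definition ext1 : ext F N := [ffun S => (S == set0)%:R].

Definition form1 (xi : 'rV[F]_N) : ext F N :=
  [ffun S => \sum_(i < N | S == [set i]) xi 0 i].

(* iota_(e_i) e^T = (-1) ^+ #{j in T | j < i} *: e^(T :\ i) if i \in T,
   and 0 otherwise. *)
Definition contract (X : 'cV[F]_N) a : ext F N :=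
  [ffun S : {set 'I_N} => \sum_(i < N | i \notin S)
     X i 0 * (-1) ^+ #|[set j in S | (j < i)%N]| * a (i |: S)].

Definition clifford (u : gtan F N) a : ext F N :=
  contract u.1 a + wedge (form1 u.2) a.

Definition homogeneous (p : nat) a : Prop :=
  forall S, #|S| <> p -> a S = 0.

Definition ext_pow a (m : nat) : ext F N := iter m (wedge a) ext1.

(* Only used for 2-forms a, for which the powers of exponent > N vanish. *)
Definition ext_exp a : ext F N :=
  \sum_(m < N.+1) (m`!%:R)^-1 *: ext_pow a m.

(* The scalar c can be absorbed in theta_1 when k > 0; for k = 0 these are the
   nonzero constants. *)
Definition decomposable (k : nat) a : Prop :=
  exists (c : F) (theta : 'M[F]_(k, N)),
    [/\ c != 0, row_free theta &
        a = c *: \big[wedge/ext1]_(i < k) form1 (row i theta)].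

End ExteriorAlgebra.

Section GeneralizedComplex.
Variables (R : realType) (N : nat).
Implicit Types (u v : gtan R N) (w z : gtan R[i] N).

Definition gRe w : gtan R N :=
  (map_mx (@complex.Re R) w.1, map_mx (@complex.Re R) w.2).
Definition gIm w : gtan R N :=
  (map_mx (@complex.Im R) w.1, map_mx (@complex.Im R) w.2).
Definition gComplex u v : gtan R[i] N :=
  (map2_mx (@Complex R) u.1 v.1, map2_mx (@Complex R) u.2 v.2).

(* C-linear and C-bilinear extensions of R-(bi)linear maps. *)
Definition clin (f : gtan R N -> gtan R N) w : gtan R[i] N :=
  gComplex (f (gRe w)) (f (gIm w)).
Definition cbilin (f : gtan R N -> gtan R N -> gtan R N) w z : gtan R[i] N :=
  gComplex (f (gRe w) (gRe z) - f (gIm w) (gIm z))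
           (f (gRe w) (gIm z) + f (gIm w) (gRe z)).

Definition pairing u v : R :=
  2^-1 * ((u.2 *m v.1) 0 0 + (v.2 *m u.1) 0 0).

Section Bracket.
Variable br : 'cV[R]_N -> 'cV[R]_N -> 'cV[R]_N.

Definition coad (X : 'cV[R]_N) (eta : 'rV[R]_N) : 'rV[R]_N :=
  \row_j - (eta *m br X (delta_mx j 0)) 0 0.

Definition courant u v : gtan R N :=
  (br u.1 v.1, coad u.1 v.2 - coad v.1 u.2).

Definition i_eigenspace (J : gtan R N -> gtan R N) w : Prop :=
  clin J w = (0 +i* 1) *: w.

Definition generalized_complex (J : {linear gtan R N -> gtan R N}) : Prop :=
  [/\ forall u, J (J u) = - u,
      forall u v, pairing (J u) (J v) = pairing u v &
      forall w z, i_eigenspace J w -> i_eigenspace J z ->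
        i_eigenspace J (cbilin courant w z)].

End Bracket.

Definition cform (a b : ext R N) : ext R[i] N := [ffun S => a S +i* b S].

Definition conj_form (a : ext R[i] N) : ext R[i] N := [ffun S => conjc (a S)].

Definition spinor_of_type (k : nat) (rho : ext R[i] N) : Prop :=
  exists (B omega : ext R N) (Omega : ext R[i] N),
    [/\ homogeneous 2 B, homogeneous 2 omega, decomposable k Omega,
        rho = wedge (ext_exp (cform B omega)) Omega &
        wedge (wedge (ext_pow (cform omega 0) (N./2 - k)) Omega)
              (conj_form Omega) <> 0].

(* rho generates the canonical line K_L of L, the i-eigenspace of J. *)
Definition canonical_generator (J : gtan R N -> gtan R N)
    (rho : ext R[i] N) : Prop :=
  rho <> 0 /\ (forall w, i_eigenspace J w <-> clifford w rho = 0).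

Definition has_type (J : gtan R N -> gtan R N) (k : nat) : Prop :=
  exists rho, canonical_generator J rho /\ spinor_of_type k rho.

End GeneralizedComplex.

(* Main.v *)
Require Import Defs.
From HB Require Import structures.
From mathcomp Require Import all_boot all_order all_algebra.
From mathcomp Require Import reals complex.
From mathcomp Require Import zify ring.

Set Implicit Arguments.
Unset Strict Implicit.
Unset Printing Implicit Defensive.

Import Order.TTheory GRing.Theory Num.Theory.
Local Open Scope ring_scope.

(** Let L be the i-eigenspace of J in the complexification of the sum of g and its
    dual, and let Theta be the space of the covectors that L contains. Writing the
    canonical generator as exp(B + i omega) /\ theta_1 /\ ... /\ theta_k, every
    theta_i wedges it to zero and hence lies in Theta, so that k <= dim Theta
    ([type_le_rank]).

    As L meets its conjugate trivially, so does Theta. Restricting covectors from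
    g to the ideal h kills only the line of e^0, so the sum of Theta and its
    conjugate, which is direct, loses at most one dimension. Therefore the
    restriction U of Theta has the dimension of Theta and meets its conjugate in
    dimension at most one ([rank_eigen_covectors]). Since J is real, L contains an
    element whose vector part has a nonzero e_0-component; its Courant bracket with
    a covector xi of Theta is, on h, a nonzero multiple of xi A, so U is
    A-invariant ([rsubmx_eigen_covectors_stable]).

    What remains is linear algebra: how large can a complex A-invariant U be when
    its overlap, the dimension of U meet conj U, is given? Apply successively real
    factors M_i = A - x_i to U and to the real space P = U + conj U, of dimension
    2 dim U - overlap U. Each M_i makes P lose at most as many dimensions as it
    makes the whole image of M_0 ... M_(i-1) lose, and U loses half of what P
    loses, up to the change of the overlap, which can only decrease. Summing up,
    [rank_invariant] bounds dim U by the overlap plus half of each successive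
    rank drop, rounded down, plus half of the last rank, rounded down.

    (1) Take for the x_i the roots of the characteristic polynomial. Each rank
    drops by at most one because eigenspaces are lines, half of which rounds down
    to zero, and the final product vanishes by Cayley-Hamilton: dim U is the
    overlap, at most one.

    (2) Take x_i = lam for 2n - 1 steps. The drop from the i-th to the next
    power of A - lam is at most the number of Jordan blocks of size greater than i
    ([rank_drop_jordan]), and the final rank is 2n - 1 - m_lam. The halves of these
    numbers, rounded down, sum over i to at most m_2 + m_4 + ..., by conjugating
    the partition ([sum_half_count_le]). *)

(** * Exterior algebra *)

Section Exterior.
Variables (F : fieldType) (N : nat).
Implicit Types (a b c : ext F N) (S T : {set 'I_N}) (xi eta : 'rV[F]_N).

Lemma inversionsE S T :
  inversions S T = (\sum_(i in S) \sum_(j in T) (j < i))%N.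
Proof.
rewrite /inversions -sum1_card pair_big_dep /=.
rewrite [RHS](bigID (fun p : 'I_N * 'I_N => p.2 < p.1)%N) /=.
rewrite [X in (_ + X)%N]big1 ?addn0; last by move=> p /andP[_ /negbTE->].
apply: eq_big => [p|p]; first by rewrite inE andbA.
by rewrite inE => /and3P[_ _ ->].
Qed.

Lemma inversionsUl S1 S2 T : [disjoint S1 & S2] ->
  inversions (S1 :|: S2) T = (inversions S1 T + inversions S2 T)%N.
Proof.
by move=> dS; rewrite !inversionsE -bigU //=; apply: eq_bigl => i; rewrite inE.
Qed.

Lemma inversionsUr S T1 T2 : [disjoint T1 & T2] ->
  inversions S (T1 :|: T2) = (inversions S T1 + inversions S T2)%N.
Proof.
move=> dT; rewrite !inversionsE -big_split /=; apply: eq_bigr => i _.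
by rewrite -bigU //=; apply: eq_bigl => j; rewrite inE.
Qed.

Lemma inversions_swap S T : [disjoint S & T] ->
  (inversions S T + inversions T S = #|S| * #|T|)%N.
Proof.
move=> dST; rewrite !inversionsE [X in (_ + X)%N]exchange_big -big_split /=.
rewrite -sum_nat_const; apply: eq_bigr => i iS.
rewrite -big_split -sum1_card /=; apply: eq_bigr => j jT.
have: i != j by apply: contraTneq iS => ->; rewrite (disjointFl dST).
by rewrite -val_eqE; case: ltngtP.
Qed.

(** Both sides sum over the splittings of S in three parts T, T', C, with the
    number of inversions between distinct parts as the exponent of the sign. *)
Lemma wedgeA a b c : wedge a (wedge b c) = wedge (wedge a b) c.
Proof.
apply/ffunP => S; rewrite !ffunE.
under [RHS]eq_bigr => T _ do rewrite ffunE mulr_sumr mulr_suml.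
rewrite (exchange_big_dep (fun T => T \in powerset S)) /=; last first.
  by move=> T T'; rewrite !powersetE => TS /subset_trans; apply.
apply: eq_bigr => T; rewrite powersetE => TS; rewrite ffunE mulr_sumr.
rewrite [RHS](reindex_onto (fun T' => T :|: T') (fun U => U :\: T)) /=; last first.
  move=> U /andP[_]; rewrite powersetE => TU.
  by rewrite -{1}(setIidPr TU) setID.
apply: eq_big => [T'|T'].
  rewrite !powersetE subsetD subUset TS subsetUl andbT /=.
  by rewrite setDUl setDv set0U (sameP eqP setDidPl) andbC.
rewrite powersetE subsetD => /andP[T'S dT'].
have dTT' : [disjoint T & T'] by rewrite disjoint_sym.
have -> : (T :|: T') :\: T = T' by rewrite setDUl setDv set0U; apply/setDidPl.
set C := S :\: (T :|: T').
have -> : S :\: T = T' :|: C.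
  have T'ST : T' \subset S :\: T by rewrite subsetD T'S.
  by rewrite /C -setDDl -{1}(setIidPr T'ST) setID.
have dT'C : [disjoint T' & C].
  have := subxx C; rewrite {2}/C subsetD disjoint_sym => /andP[_].
  by apply: disjointWl; apply: subsetUr.
have -> : (T' :|: C) :\: T' = C.
  by rewrite setDUl setDv set0U; apply/setDidPl; rewrite disjoint_sym.
rewrite inversionsUr // inversionsUl // !exprD /=.
by move: (a T) (b T') (c C) => x y z; ring.
Qed.

(** Exchanging the two parts of a splitting trades the inversions for the
    pairs that are not inverted, and there are p q pairs in all. *)
Lemma wedgeC p q a b : homogeneous p a -> homogeneous q b ->
  wedge b a = (-1) ^+ (p * q) *: wedge a b.
Proof.
move=> ha hb; apply/ffunP => S; rewrite !ffunE scaler_sumr.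
rewrite (reindex_onto (fun T => S :\: T) (fun T => S :\: T)) /=; last first.
  by move=> T; rewrite powersetE => /setIidPr TS; rewrite setDDr setDv set0U.
apply: eq_big => [T|T].
  rewrite !powersetE subsetDl setDDr setDv set0U /=.
  by apply/eqP/idP => [<-|/setIidPr //]; apply: subsetIl.
move=> /andP[_ /eqP TS]; rewrite TS.
have [cT|/eqP/ha->] := eqVneq #|T| p; last by rewrite !(mulr0, mul0r, scaler0).
have [cT'|/eqP/hb->] := eqVneq #|S :\: T| q; last by rewrite !(mulr0, mul0r, scaler0).
have dT : [disjoint T & S :\: T].
  by have := subxx (S :\: T); rewrite subsetD disjoint_sym => /andP[].
have := inversions_swap dT; rewrite cT cT' => <-.
rewrite exprD /GRing.scale /=.
have := sqrr_sign F (inversions T (S :\: T)).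
by move: (_ ^+ inversions T _) (a T) (b _) => s x y s2; ring: s2.
Qed.

Lemma wedgeDl a b c : wedge (a + b) c = wedge a c + wedge b c.
Proof.
apply/ffunP => S; rewrite !ffunE -big_split; apply: eq_bigr => T _ /=.
by rewrite ffunE mulrDr mulrDl.
Qed.

Lemma wedgeDr a b c : wedge a (b + c) = wedge a b + wedge a c.
Proof.
apply/ffunP => S; rewrite !ffunE -big_split; apply: eq_bigr => T _ /=.
by rewrite ffunE mulrDr.
Qed.

Lemma wedgeZl (x : F) a b : wedge (x *: a) b = x *: wedge a b.
Proof.
apply/ffunP => S; rewrite !ffunE scaler_sumr; apply: eq_bigr => T _.
by rewrite ffunE /GRing.scale /= mulrCA !mulrA.
Qed.

Lemma wedgeZr (x : F) a b : wedge a (x *: b) = x *: wedge a b.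
Proof.
apply/ffunP => S; rewrite !ffunE scaler_sumr; apply: eq_bigr => T _.
by rewrite ffunE /GRing.scale /= mulrCA.
Qed.

Lemma wedge0l a : wedge 0 a = 0.
Proof. by rewrite -(scale0r (0 : ext F N)) wedgeZl !scale0r. Qed.

Lemma wedge0r a : wedge a 0 = 0.
Proof. by rewrite -(scale0r (0 : ext F N)) wedgeZr !scale0r. Qed.

Lemma form1_homogeneous xi : homogeneous 1 (form1 xi).
Proof.
move=> S S1; rewrite ffunE big1 // => i /eqP Si.
by case: S1; rewrite Si cards1.
Qed.

Lemma ext1_homogeneous : homogeneous 0 (ext1 F N).
Proof. by move=> S; rewrite ffunE => /eqP; rewrite cards_eq0 => /negbTE->. Qed.

Lemma form1_anticomm xi eta :
  wedge (form1 xi) (form1 eta) = - wedge (form1 eta) (form1 xi).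
Proof.
rewrite (wedgeC (form1_homogeneous eta) (form1_homogeneous xi)).
by rewrite expr1 scaleN1r.
Qed.

Lemma form1_wedge_self xi : 2 != 0 :> F -> wedge (form1 xi) (form1 xi) = 0.
Proof.
move=> two_neq0; apply: (scalerI two_neq0).
by rewrite scaler0 scaler_nat mulr2n {2}form1_anticomm subrr.
Qed.

(** The factor equal to the form on the left is reached by anticommuting past the
    earlier ones, and the square of a 1-form is zero. *)
Lemma form1_wedge_big (I : eqType) (r : seq I) (theta : I -> 'rV[F]_N) i :
  2 != 0 :> F -> i \in r ->
  wedge (form1 (theta i)) (\big[@wedge F N/@ext1 F N]_(j <- r) form1 (theta j)) = 0.
Proof.
move=> two_neq0; elim: r => // j r IHr; rewrite inE big_cons wedgeA.
case: eqP => [-> _|_ /= ir]; first by rewrite form1_wedge_self ?wedge0l.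
by rewrite form1_anticomm -scaleN1r wedgeZl -wedgeA IHr // wedge0r scaler0.
Qed.

(** A form of even degree is central, and so is its exponential. *)
Lemma form1_comm_exp xi a : homogeneous 2 a ->
  wedge (form1 xi) (ext_exp a) = wedge (ext_exp a) (form1 xi).
Proof.
move=> a2; apply: (big_rec (fun x => wedge (form1 xi) x = wedge x (form1 xi))).
  by rewrite wedge0l wedge0r.
move=> m x _ IH; rewrite wedgeDl wedgeDr IH wedgeZl wedgeZr; congr (_ *: _ + _).
elim: (m : nat) => [|p IHp] /=.
  by rewrite (wedgeC (form1_homogeneous xi) ext1_homogeneous) muln0 scale1r.
rewrite wedgeA (wedgeC a2 (form1_homogeneous xi)) expr2 mulrNN mul1r scale1r.
by rewrite -!wedgeA IHp.
Qed.

(** The covectors of the decomposable factor of a spinor annihilate the spinor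
    under the Clifford action. *)
Lemma form1_wedge_spinor k a (theta : 'M[F]_(k, N)) (c : F) i :
  2 != 0 :> F -> homogeneous 2 a ->
  wedge (form1 (row i theta))
    (wedge (ext_exp a)
       (c *: \big[@wedge F N/@ext1 F N]_(j < k) form1 (row j theta))) = 0.
Proof.
move=> two_neq0 a2; rewrite wedgeA form1_comm_exp // -wedgeA wedgeZr.
by rewrite (form1_wedge_big (fun j => row j theta)) ?mem_index_enum // scaler0 wedge0r.
Qed.

Lemma contract0 a : contract 0 a = 0.
Proof. by apply/ffunP => S; rewrite !ffunE big1 // => i _; rewrite mxE !mul0r. Qed.

End Exterior.

(** * Invariant subspaces and conjugation *)

Section ConjugateOverlap.
Variables (F : fieldType) (sigma : {rmorphism F -> F}).
Local Notation "U ^s" := (map_mx sigma U) (at level 2, format "U ^s") : ring_scope.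

(** For complex conjugation, the intersection of U with its conjugate is the
    complexification of a real space, whose dimension this is. *)
Definition overlap k d (U : 'M[F]_(k, d)) : nat := \rank (U :&: U^s)%MS.

Lemma rank_addsmx_conj k d (U : 'M[F]_(k, d)) :
  (\rank (U + U^s)%MS + overlap U = (\rank U).*2)%N.
Proof. by rewrite mxrank_sum_cap mxrank_map addnn. Qed.

Lemma rank_le_half k d q (U : 'M[F]_(k, d)) (Q : 'M[F]_(q, d)) :
  Q^s = Q -> (U <= Q)%MS -> (\rank U <= overlap U + (\rank Q)./2)%N.
Proof.
move=> Qs UQ; have := rank_addsmx_conj U.
have : (\rank (U + U^s)%MS <= \rank Q)%N.
  by rewrite mxrankS // addsmx_sub UQ -Qs map_submx.
lia.
Qed.

Lemma overlap_le k l d (U : 'M[F]_(k, d)) (V : 'M[F]_(l, d)) :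
  (V <= U)%MS -> (overlap V <= overlap U)%N.
Proof. by move=> VU; rewrite mxrankS // capmxS // map_submx. Qed.

(** The drop is the dimension of the intersection with the kernel of M. *)
Lemma rank_drop_le k l d e (P : 'M[F]_(k, d)) (Q : 'M[F]_(l, d)) (M : 'M[F]_(d, e)) :
  (P <= Q)%MS -> (\rank P - \rank (P *m M) <= \rank Q - \rank (Q *m M))%N.
Proof.
move=> PQ; have := mxrank_mul_ker P M; have := mxrank_mul_ker Q M.
have : (\rank (P :&: kermx M) <= \rank (Q :&: kermx M))%N by rewrite mxrankS ?capmxS.
lia.
Qed.

(** U + conj U has dimension 2 dim U - overlap U, and M, being real, maps it to
    the same sum for U M; so twice the drop of dim U is the drop of dim (U + conj U)
    plus that of the overlap. The first is at most the drop of dim Q, and the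
    second is nonnegative, so the half that is lost by rounding is absorbed by
    counting the drop of the overlap in full. *)
Lemma rank_step k d q (U : 'M[F]_(k, d)) (Q : 'M[F]_(q, d)) (M : 'M[F]_d) :
  Q^s = Q -> M^s = M -> (U <= Q)%MS -> (U *m M <= U)%MS ->
  (\rank U + overlap (U *m M) <=
   \rank (U *m M) + overlap U + (\rank Q - \rank (Q *m M))./2)%N.
Proof.
move=> Qs Ms UQ UM; have := rank_addsmx_conj U; have := rank_addsmx_conj (U *m M).
have -> : \rank (U *m M + (U *m M)^s)%MS = \rank ((U + U^s)%MS *m M).
  by rewrite map_mxM Ms; apply/esym/eqmx_rank/eqmxP/addsmxMr.
have /rank_drop_le-/(_ _ M) : (U + U^s <= Q)%MS by rewrite addsmx_sub UQ -Qs map_submx.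
have := overlap_le UM; have := mxrankM_maxl (U + U^s)%MS M.
lia.
Qed.

(** The bound telescopes [rank_step] along the images of U under the products P i,
    which remain B-invariant, and ends with [rank_le_half]. *)
Lemma rank_invariant k d (U : 'M[F]_(k, d)) (B : 'M[F]_d) (x : nat -> F) r :
  let P i := \prod_(j < i) (B - (x j)%:M) in
  B^s = B -> (forall i, sigma (x i) = x i) -> (U *m B <= U)%MS ->
  (\rank U <= overlap U
     + (\sum_(i < r) (\rank (P i) - \rank (P i.+1))./2 + (\rank (P r))./2))%N.
Proof.
move=> P Bs xs UB.
have PS i : P i.+1 = P i *m (B - (x i)%:M) by rewrite /P big_ord_recr.
have Ms i : (B - (x i)%:M)^s = B - (x i)%:M by rewrite map_mxB Bs map_scalar_mx /= xs.
have Ps i : (P i)^s = P i.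
  elim: i => [|i IHi]; last by rewrite PS map_mxM IHi Ms.
  by rewrite /P big_ord0 map_mx1.
have UP i : (U *m P i *m B <= U *m P i)%MS.
  elim: i => [|i IHi]; first by rewrite /P big_ord0 mulmx1.
  have cB : (B - (x i)%:M) *m B = B *m (B - (x i)%:M).
    by rewrite mulmxBl mulmxBr scalar_mxC.
  by rewrite PS mulmxA -[X in (X <= _)%MS]mulmxA cB mulmxA submxMr.
have step i : (\rank U + overlap (U *m P i) <=
    \rank (U *m P i) + overlap U + \sum_(j < i) (\rank (P j) - \rank (P j.+1))./2)%N.
  elim: i => [|i IHi]; first by rewrite big_ord0 /P big_ord0 mulmx1; lia.
  have UM : (U *m P i *m (B - (x i)%:M) <= U *m P i)%MS.
    by rewrite mulmxBr addmx_sub // eqmx_opp mul_mx_scalar scalemx_sub.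
  have := rank_step (Ps i) (Ms i) (submxMl U (P i)) UM.
  rewrite big_ord_recr /= PS mulmxA; move: IHi.
  by set s := (\sum_(_ < i) _)%N; set t := (_./2); lia.
have := rank_le_half (Ps r) (submxMl U (P r)); have := step r; lia.
Qed.

End ConjugateOverlap.

(** * Ranks of powers and Jordan blocks *)

Section JordanRanks.
Variable F : fieldType.

Lemma trmxX d (M : 'M[F]_d) i : (M ^+ i)^T = M^T ^+ i.
Proof.
elim: i => [|i IHi]; first by rewrite !expr0 trmx1.
by rewrite exprS exprSr trmx_mul IHi.
Qed.

Lemma jordan_block_shift (lam : F) m :
  jordan_block lam m = lam%:M + jordan_block 0 m.
Proof. by apply/matrixP => i j; rewrite !mxE mul0rn add0r. Qed.

Lemma jordan_block0_exp m i (a b : 'I_m) :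
  (jordan_block (0 : F) m ^+ i) a b = (b == (a + i)%N :> nat)%:R.
Proof.
elim: i a b => [|i IHi] a b; first by rewrite expr0 mxE addn0 eq_sym.
rewrite exprSr -mulmxE mxE.
under eq_bigr => c _ do rewrite IHi mxE mul0rn add0r -natrM mulnb.
have [am|am] := ltnP (a + i)%N m.
  rewrite (bigD1 (Ordinal am)) //= eqxx big1 ?addr0 ?addnS // => c.
  by rewrite -val_eqE /= => /negbTE->.
rewrite big1 => [|c _]; last by rewrite ltn_eqF // (leq_trans (ltn_ord c)).
by rewrite ltn_eqF // (leq_trans (ltn_ord b)) // addnS ltnW.
Qed.

Lemma rank_ker_jordan_block0 m : (\rank (kermx (jordan_block (0 : F) m)) <= 1)%N.
Proof.
case: m => [|m]; first by rewrite (leq_trans (rank_leq_row _)).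
suff /mxrankS/leq_trans : (kermx (jordan_block (0 : F) m.+1) <=
  (delta_mx 0 ord_max : 'rV_m.+1))%MS by apply; apply: rank_leq_row.
apply/row_subP => i; set u := row i _.
have uJ : u *m jordan_block 0 m.+1 = 0 by rewrite -row_mul mulmx_ker row0.
clearbody u.
suff -> : u = u 0 ord_max *: delta_mx 0 ord_max by apply: scalemx_sub.
apply/rowP => j; rewrite [RHS]mxE [X in _ = _ * X]mxE eqxx /=.
have [->|jm] := eqVneq j ord_max; first by rewrite mulr1.
have j1m : (j.+1 < m.+1)%N.
  move: jm (ltn_ord j); rewrite -val_eqE /= => jm.
  by rewrite !ltnS leq_eqVlt (negbTE jm).
have /rowP/(_ (Ordinal j1m)) := uJ; rewrite mulr0 !mxE (bigD1 j) //= !mxE /=.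
rewrite mul0rn add0r eqxx mulr1 big1 ?addr0 // => l lj; rewrite mxE mul0rn add0r /=.
by rewrite eqSS eq_sym val_eqE (negbTE lj) mulr0.
Qed.

(** A nilpotent Jordan block has a one-dimensional kernel, so each power loses one
    rank until the power m, which is zero. *)
Lemma rank_drop_jordan_block0 m i :
  (\rank (jordan_block (0 : F) m ^+ i) - \rank (jordan_block (0 : F) m ^+ i.+1)
   <= (i < m))%N.
Proof.
have [im|mi] := ltnP i m.
  have := mxrank_mul_ker (jordan_block (0 : F) m ^+ i) (jordan_block 0 m).
  have := rank_ker_jordan_block0 m.
  have := mxrankS (capmxSr (jordan_block (0 : F) m ^+ i) (kermx (jordan_block 0 m))).
  by rewrite mulmxE -exprSr; lia.
suff -> : jordan_block (0 : F) m ^+ i = 0 by rewrite mxrank0.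
apply/matrixP => a b; rewrite jordan_block0_exp mxE ltn_eqF //.
by rewrite (leq_trans (ltn_ord b)) // (leq_trans mi) // leq_addl.
Qed.

Lemma mul_mxdiag n (p : 'I_n -> nat) (B C : forall i, 'M[F]_(p i)) :
  \mxdiag_i B i *m \mxdiag_i C i = \mxdiag_i (B i *m C i).
Proof.
rewrite {2}/mxdiag mul_mxdiag_mxblock; apply/eq_mxblock => i j.
by case: eqVneq => [->|_]; rewrite ?mulmx0 // !conform_mx_id.
Qed.

Lemma mxdiagX n (p : 'I_n -> nat) (B : forall i, 'M[F]_(p i)) k :
  (\mxdiag_i B i) ^+ k = \mxdiag_i (B i ^+ k).
Proof.
elim: k => [|k IHk]; first exact/esym/mxdiagZ.
rewrite exprS IHk -mulmxE mul_mxdiag.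
by apply: eq_mxdiag => i; rewrite exprS.
Qed.

Variables (d : nat) (A : 'M[F]_d) (lam : F) (m : seq nat).
Hypothesis mJ : jordan_sizes A lam m.
Let N := A - lam%:M.

Let sumn_sizes : (\sum_(i < size m) nth 0%N m i)%N = sumn m.
Proof. by rewrite sumnE [RHS](big_nth 0%N) big_mkord. Qed.

(** For i <= d the kernel of N ^+ i is contained in the generalized eigenspace, so
    it can be computed in the Jordan basis V: outside of this space N has no
    kernel. *)
Lemma rank_jordan_exp i : (i <= d)%N ->
  (\rank (N ^+ i) + sumn m =
   d + \sum_(j < size m) \rank (jordan_block (0 : F) (nth 0%N m j) ^+ i))%N.
Proof.
have [_ _ [V [Vfree Veig AV]]] := mJ; move=> id.
have NV : N *m V = V *m \mxdiag_(j < size m) jordan_block 0 (nth 0%N m j).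
  rewrite mulmxBl AV (eq_mxdiag (fun j => jordan_block_shift lam (nth 0%N m j))).
  by rewrite mxdiagD mxdiagZ mulmxDr mul_scalar_mx mul_mx_scalar addrAC subrr add0r.
have NiV : N ^+ i *m V = V *m \mxdiag_(j < size m) (jordan_block 0 (nth 0%N m j) ^+ i).
  rewrite -mxdiagX; elim: i {id} => [|i IHi]; first by rewrite !expr0 mul1mx mulmx1.
  by rewrite exprSr -mulmxE -mulmxA NV mulmxA IHi exprSr -mulmxA.
have KV : (kermx (N ^+ i)^T <= V^T)%MS.
  rewrite Veig /N; case: (d) (A) id => [|d'] A' id; first by rewrite thinmx0 sub0mx.
  rewrite geigenspaceE sub_kermx -[A'^T - _](_ : (A' - lam%:M)^T = _); last first.
    by rewrite linearB /= tr_scalar_mx.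
  have -> (M : 'M[F]_d'.+1) : M ^+ d'.+1 = M ^+ i * M ^+ (d'.+1 - i).
    by rewrite -exprD subnKC.
  by rewrite -trmxX -mulmxE mulmxA mulmx_ker mul0mx.
have := mxrank_mul_ker V^T (N ^+ i)^T.
rewrite -trmx_mul NiV trmx_mul mxrankMfree // (mxrank_tr (\mxdiag__ _)) rank_mxdiag.
rewrite (capmx_idPr KV) mxrank_ker (mxrank_tr (N ^+ i)) (eqP Vfree) sumn_sizes.
by move=> <-; rewrite addnCA subnKC ?rank_leq_row // addnC.
Qed.

Lemma rank_drop_jordan i : (i < d)%N ->
  (\rank (N ^+ i) - \rank (N ^+ i.+1) <= count (fun p => i < p) m)%N.
Proof.
move=> id; have := rank_jordan_exp (ltnW id); have := rank_jordan_exp id.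
have -> : count (fun p => i < p)%N m = (\sum_(j < size m) (i < nth 0 m j))%N.
  rewrite -sum1_count (big_nth 0%N) big_mkord big_mkcond.
  by apply: eq_bigr => j _; case: ltnP.
have : (\sum_(j < size m) \rank (jordan_block (0 : F) (nth 0 m j) ^+ i) <=
  \sum_(j < size m) \rank (jordan_block (0 : F) (nth 0 m j) ^+ i.+1) +
  \sum_(j < size m) (i < nth 0 m j))%N.
  rewrite -big_split leq_sum // => j _ /=; rewrite -leq_subLR.
  exact: rank_drop_jordan_block0.
by lia.
Qed.

Lemma rank_geigenspace_exp : \rank (N ^+ d) = (d - sumn m)%N.
Proof.
have [_ _ [V [Vfree Veig _]]] := mJ.
have : \rank (geigenspace A^T lam) = sumn m by rewrite -Veig (eqP Vfree) sumn_sizes.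
rewrite /N; case: (d) (A) => [|d'] A'.
  by have := rank_leq_row ((A' - lam%:M) ^+ 0); lia.
rewrite geigenspaceE mxrank_ker -(mxrank_tr (_ ^+ d'.+1)) trmxX linearB /= tr_scalar_mx.
by move=> <-; rewrite subKn // rank_leq_row.
Qed.

End JordanRanks.

(** * Bounds for invariant subspaces of a real matrix *)

Lemma count_gt_sorted (m : seq nat) i q : sorted geq m ->
  (q < count (fun p => i < p)%N m)%N -> (i < nth 0 m q)%N.
Proof.
elim: m q => [|p m IHm] q //= pm.
have [ip|pi] := ltnP i p; last first.
  have geq_tr : transitive geq by move=> b a c /= ba cb; apply: leq_trans cb ba.
  rewrite (@eq_in_count _ _ pred0) ?count_pred0 // => p' p'm /=.
  apply/negbTE; rewrite -leqNgt (leq_trans _ pi) //.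
  exact: (allP (order_path_min geq_tr pm)).
by case: q => [|q] // /IHm; apply; apply: path_sorted pm.
Qed.

(** The counts of parts greater than i, for i = 0, 1, ..., form the conjugate
    partition of m. Half of such a count, rounded down, is the number of
    even-numbered parts m_2, m_4, ... that are greater than i, because the parts
    decrease; summing over i counts each of these parts with its size. *)
Lemma sum_half_count_le (m : seq nat) r : sorted geq m ->
  (\sum_(i < r) (count (fun p => i < p)%N m)./2 <=
   \sum_(1 <= j < (size m)./2.+1) nth 0 m (2 * j).-1)%N.
Proof.
move=> m_sorted.
have half i : ((count (fun p => i < p) m)./2 <=
    \sum_(1 <= j < (size m)./2.+1) (i < nth 0 m (2 * j).-1))%N.
  set c := count _ m; have cm : (c <= size m)%N := count_size _ m.
  rewrite (@big_cat_nat _ _ _ c./2.+1) //=; last by rewrite ltnS half_leq.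
  rewrite (eq_big_nat _ _ (F2 := fun=> 1%N)) => [|j /andP[j0 jc]]; last first.
    by rewrite count_gt_sorted // -/c; lia.
  by rewrite sum_nat_const_nat muln1 subn1 leq_addr.
apply: (@leq_trans (\sum_(i < r) \sum_(1 <= j < (size m)./2.+1)
  (i < nth 0 m (2 * j).-1))%N); first by apply: leq_sum => i _; apply: half.
rewrite exchange_big leq_sum // => j _; move: (nth _ _ _) => p.
suff -> : (\sum_(i < r) (i < p))%N = minn r p by apply: geq_minr.
elim: r => [|r IHr]; first by rewrite big_ord0 min0n.
by rewrite big_ord_recr /= IHr; lia.
Qed.

Lemma rank_eigenspace_tr (F : fieldType) d (A : 'M[F]_d) a :
  \rank (eigenspace A^T a) = \rank (eigenspace A a).
Proof.
by rewrite !mxrank_ker -(mxrank_tr (A - _)) linearB /= tr_scalar_mx.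
Qed.

Lemma eigenvalue_tr (F : fieldType) d (A : 'M[F]_d) a :
  eigenvalue A^T a = eigenvalue A a.
Proof. by rewrite /eigenvalue -!mxrank_eq0 rank_eigenspace_tr. Qed.

(** The Cayley-Hamilton theorem, with the characteristic polynomial split. *)
Lemma prod_char_roots (F : closedFieldType) d (A : 'M[F]_d) :
  exists rs : seq F, {in rs, forall z, eigenvalue A z} /\
    \prod_(j < size rs) (A - (rs`_j)%:M) = 0.
Proof.
have [rs] := closed_field_poly_normal (char_poly A).
rewrite (monicP (char_poly_monic A)) scale1r => rsE; exists rs; split.
  by move=> z zrs; rewrite eigenvalue_root_char rsE root_prod_XsubC.
case: d A rsE => [|d] A rsE; first by apply/matrixP => -[].
rewrite -(Cayley_Hamilton A) rsE rmorph_prod /= (big_nth 0) big_mkord.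
by apply: eq_bigr => j _; rewrite rmorphB /= horner_mx_X horner_mx_C.
Qed.

Section RealMatrix.
Variables (R : rcfType) (k d : nat) (A : 'M[R]_d) (U : 'M[R[i]]_(k, d)).
Local Notation AC := (map_mx (real_complex R) A).
Hypothesis UA : (U *m AC <= U)%MS.

Let AC_conj : map_mx conjc AC = AC.
Proof. by apply/matrixP => i j; rewrite !mxE /= oppr0. Qed.

(** In other words U is its own conjugate. Eigenspaces being lines, each factor
    A - x lowers the rank by at most one, and half of one rounds down to zero. *)
Lemma rank_invariant_real_nonderogatory :
  (forall z : R[i], eigenvalue AC^T z -> complex.Im z = 0) ->
  (forall lam : R, eigenvalue A^T lam -> \rank (eigenspace A^T lam) = 1%N) ->
  (\rank U <= overlap conjc U)%N.
Proof.
move=> spec geom.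
have [rs [rs_eig rs0]] := prod_char_roots AC.
have rs_real j : complex.Im rs`_j = 0.
  have [js|sj] := ltnP j (size rs); last by rewrite nth_default.
  by apply: spec; rewrite eigenvalue_tr rs_eig // mem_nth.
have rs_conj j : conjc rs`_j = rs`_j.
  by move: (rs_real j); case: (rs`_j) => a b /= ->; rewrite oppr0.
apply: leq_trans (rank_invariant (size rs) AC_conj rs_conj UA) _.
rewrite rs0 mxrank0 addn0 big1 ?addn0 // => j _.
rewrite big_ord_recr /=; set P := \prod_(_ < _) _.
have : (\rank P - \rank (P *m (AC - (rs`_j)%:M)) <= 1)%N.
  rewrite -(mxrank_mul_ker P (AC - (rs`_j)%:M)) addKn.
  apply: leq_trans (mxrankS (capmxSr P (kermx (AC - (rs`_j)%:M)))) _.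
  have rsjE : rs`_j = real_complex R (complex.Re rs`_j).
    by move: (rs_real j); case: (rs`_j) => a b /= ->.
  suff -> : \rank (kermx (AC - (rs`_j)%:M)) = 1%N by [].
  have := rs_eig _ (mem_nth 0 (ltn_ord j)).
  rewrite rsjE /eigenvalue /eigenspace -map_scalar_mx -map_mxB -map_kermx map_mx_eq0.
  by rewrite mxrank_map -[_ != 0]eigenvalue_tr -rank_eigenspace_tr; apply: geom.
by rewrite mulmxE; case: (_ - _)%N => [|[]].
Qed.

Lemma rank_invariant_jordan lam m : jordan_sizes A lam m ->
  (\rank U <= overlap conjc U +
     (\sum_(1 <= j < (size m)./2.+1) nth 0 m (2 * j).-1
      + (d - sumn m)./2))%N.
Proof.
move=> mJ; have [m_sorted _ _] := mJ.
have x_conj (i : nat) : conjc (lam%:C)%C = (lam%:C)%C by rewrite /= oppr0.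
apply: leq_trans (rank_invariant d AC_conj x_conj UA) _; rewrite leq_add2l.
have rP i : \rank (\prod_(j < i) (AC - (lam%:C)%C%:M)) = \rank ((A - lam%:M) ^+ i).
  rewrite -(mxrank_map (real_complex R)) big_const_ord iter_mulr_1; congr mxrank.
  elim: i => [|i IHi]; first by rewrite !expr0 map_mx1.
  by rewrite !exprS IHi map_mxM map_mxB map_scalar_mx.
rewrite rP (rank_geigenspace_exp mJ) leq_add2r.
apply: leq_trans (sum_half_count_le d m_sorted); apply: leq_sum => i _.
by rewrite !rP half_leq // rank_drop_jordan.
Qed.

End RealMatrix.

(** * The type of a generalized complex structure *)

Section ComplexParts.
Local Open Scope complex_scope.
Variables (R : realType) (N : nat).
Implicit Types (u v : gtan R N) (w : gtan R[i] N).

Lemma gComplexK w : gComplex (gRe w) (gIm w) = w.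
Proof.
case: w => X xi; congr pair; apply/matrixP => i j; rewrite !mxE.
  by case: (X i j).
by case: (xi i j).
Qed.

Lemma gRe_Complex u v : gRe (gComplex u v) = u.
Proof. by case: u v => X xi [Y eta]; congr pair; apply/matrixP => i j; rewrite !mxE. Qed.

Lemma gIm_Complex u v : gIm (gComplex u v) = v.
Proof. by case: u v => X xi [Y eta]; congr pair; apply/matrixP => i j; rewrite !mxE. Qed.

Lemma gRe_i w : gRe ((0 +i* 1) *: w) = - gIm w.
Proof.
case: w => X xi; congr pair; apply/matrixP => i j; rewrite !mxE.
  by case: (X i j) => a b /=; rewrite mul0r mul1r sub0r.
by case: (xi i j) => a b /=; rewrite mul0r mul1r sub0r.
Qed.

Lemma gIm_i w : gIm ((0 +i* 1) *: w) = gRe w.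
Proof.
case: w => X xi; congr pair; apply/matrixP => i j; rewrite !mxE.
  by case: (X i j) => a b /=; rewrite mul0r mul1r add0r.
by case: (xi i j) => a b /=; rewrite mul0r mul1r add0r.
Qed.

(** Separating real and imaginary parts turns statements on L into statements on
    the real map J. *)
Lemma i_eigenspaceP (J : gtan R N -> gtan R N) w :
  i_eigenspace J w <-> J (gRe w) = - gIm w /\ J (gIm w) = gRe w.
Proof.
split=> [Jw|[JRe JIm]].
  split; first by rewrite -gRe_i -Jw /clin gRe_Complex.
  by rewrite -[RHS]gIm_i -Jw /clin gIm_Complex.
by rewrite /i_eigenspace /clin JRe JIm -gRe_i -(gIm_i w) gComplexK.
Qed.

End ComplexParts.

Lemma map2_ComplexE (R : realType) m n (x y : 'M[R]_(m, n)) :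
  map2_mx (@Complex R) x y =
  map_mx (real_complex R) x + (0 +i* 1)%C *: map_mx (real_complex R) y.
Proof.
apply/matrixP => i j; rewrite !mxE; apply/eqP; rewrite eq_complex /=.
by rewrite !(mul0r, mul1r, mulr0, subr0, addr0, add0r) !eqxx.
Qed.

Lemma complex_mx_eq0 (R : realType) m n (x y : 'M[R]_(m, n)) :
  map_mx (real_complex R) x + (0 +i* 1)%C *: map_mx (real_complex R) y = 0 <->
  x = 0 /\ y = 0.
Proof.
split=> [xy0|[-> ->]]; last by rewrite !map_mx0 scaler0 addr0.
have xy i j : x i j = 0 /\ y i j = 0.
  have /matrixP/(_ i j) := xy0; rewrite !mxE => /eqP.
  rewrite eq_complex /= !(mul0r, mul1r, mulr0, subr0, addr0, add0r).
  by move=> /andP[/eqP-> /eqP->].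
by split; apply/matrixP => i j; rewrite mxE; case: (xy i j).
Qed.

Section Covectors.
Local Open Scope complex_scope.
Variables (R : realType) (N : nat) (J : {linear gtan R N -> gtan R N}).

(** The vector part is transposed so that both parts are linear maps between row
    vectors, which have matrices acting on the right. *)
Definition covector_image1 (xi : 'rV[R]_N) : 'rV[R]_N := (J (0, xi)).1^T.
Definition covector_image2 (xi : 'rV[R]_N) : 'rV[R]_N := (J (0, xi)).2.

Let J_covectorP (x : R) (xi eta : 'rV[R]_N) :
  J (0, x *: xi + eta) = x *: J (0, xi) + J (0, eta).
Proof. by rewrite -linearP; congr (J _); congr pair; rewrite /= scaler0 addr0. Qed.

Let covector_image1_linear : linear covector_image1.
Proof. by move=> x xi eta; rewrite /covector_image1 J_covectorP linearP. Qed.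

Let covector_image2_linear : linear covector_image2.
Proof. by move=> x xi eta; rewrite /covector_image2 J_covectorP. Qed.

HB.instance Definition _ :=
  GRing.isLinear.Build R _ _ _ covector_image1 covector_image1_linear.
HB.instance Definition _ :=
  GRing.isLinear.Build R _ _ _ covector_image2 covector_image2_linear.

(** The complex covectors of L, as the row space of a kernel: the vector part of
    J xi must vanish and its covector part must be i xi. *)
Definition eigen_covectors : 'M[R[i]]_N :=
  kermx (row_mx (map_mx (real_complex R) (lin1_mx covector_image1))
                (map_mx (real_complex R) (lin1_mx covector_image2) - (0 +i* 1)%:M)).

Lemma eigen_covectorsP (xi : 'rV[R[i]]_N) :
  (xi <= eigen_covectors)%MS <-> i_eigenspace J (0, xi).
Proof.
rewrite /eigen_covectors; set P := lin1_mx _; set Q := lin1_mx _.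
have JE (a : 'rV[R]_N) : J (0, a) = ((a *m P)^T, a *m Q).
  rewrite !mul_rV_lin1 /= /covector_image1 /covector_image2 trmxK.
  by case: (J _).
set a := (gRe (0, xi)).2; set b := (gIm (0, xi)).2.
have zRe : gRe (0, xi) = (0, a) by congr pair; rewrite /= raddf0.
have zIm : gIm (0, xi) = (0, b) by congr pair; rewrite /= raddf0.
have xiE : xi = map_mx (real_complex R) a + (0 +i* 1) *: map_mx (real_complex R) b.
  by rewrite -map2_ComplexE; apply: esym (congr1 snd (gComplexK (0, xi))).
have -> : (xi <= kermx (row_mx (map_mx (real_complex R) P)
      (map_mx (real_complex R) Q - (0 +i* 1)%:M)))%MS <->
   [/\ a *m P = 0, b *m P = 0, a *m Q = - b & b *m Q = a].
  have i2 : (0 +i* 1) * (0 +i* 1) = -1 :> R[i] by rewrite -expr2 sqr_i.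
  have aE : xi *m map_mx (real_complex R) P =
      map_mx (real_complex R) (a *m P) + (0 +i* 1) *: map_mx (real_complex R) (b *m P).
    by rewrite {1}xiE mulmxDl -scalemxAl !map_mxM.
  have bE : xi *m (map_mx (real_complex R) Q - (0 +i* 1)%:M) =
      map_mx (real_complex R) (a *m Q + b)
      + (0 +i* 1) *: map_mx (real_complex R) (b *m Q - a).
    rewrite {1}xiE mulmxBr !mulmxDl -!scalemxAl -!map_mxM !mul_mx_scalar.
    rewrite scalerA i2 scaleN1r map_mxD map_mxB scalerBr opprD opprK.
    by rewrite [in LHS](addrC (- _)) addrACA.
  split.
    move/sub_kermxP; rewrite mul_mx_row aE bE -row_mx0.
    case/eq_row_mx => /complex_mx_eq0[aP bP] /complex_mx_eq0[aQ bQ].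
    by split=> //; [apply/eqP; rewrite -addr_eq0 aQ | apply/eqP; rewrite -subr_eq0 bQ].
  case=> aP bP aQ bQ; apply/sub_kermxP; rewrite mul_mx_row aE bE -row_mx0.
  by congr row_mx; apply/complex_mx_eq0; rewrite ?aP ?bP ?aQ ?bQ ?addNr ?subrr.
rewrite i_eigenspaceP zRe zIm !JE; split.
  by case=> -> -> -> ->; rewrite trmx0; split=> //; congr pair; rewrite oppr0.
case=> Ja Jb; move: (congr1 fst Ja) (congr1 snd Ja) (congr1 fst Jb) (congr1 snd Jb).
by rewrite /= oppr0 => aP aQ bP bQ; split=> //; apply: trmx_inj; rewrite trmx0.
Qed.

End Covectors.

Lemma rank_le_rsubmx (F : fieldType) k p d (M : 'M[F]_(k, p + d)) :
  (\rank M <= p + \rank (rsubmx M))%N.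
Proof.
rewrite -{1}[M]hsubmxK -mxrank_tr tr_row_mx -addsmxE.
apply: leq_trans (mxrank_adds_leqif _ _) _.
by rewrite !mxrank_tr leq_add2r rank_leq_col.
Qed.

Lemma rsubmx_col_mx (V : Type) k l p d (M : 'M[V]_(k, p + d)) (M' : 'M[V]_(l, p + d)) :
  rsubmx (col_mx M M') = col_mx (rsubmx M) (rsubmx M').
Proof.
apply/matrixP => i j; rewrite !mxE.
by case: split => i'; rewrite mxE.
Qed.

Section AlmostAbelianType.
Local Open Scope complex_scope.
Variables (R : realType) (d : nat) (A : 'M[R]_d).
Variable J : {linear gtan R (1 + d) -> gtan R (1 + d)}.
Hypothesis gcJ : generalized_complex (almost_abelian_bracket A) J.

Local Notation Theta := (eigen_covectors J).
Local Notation U := (rsubmx Theta).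
Local Notation AC := (map_mx (real_complex R) A).

Lemma almost_abelian_bracketx0 X : almost_abelian_bracket A X 0 = 0.
Proof.
have u0 : usubmx (0 : 'cV[R]_(1 + d)) 0 0 = 0 by rewrite !mxE.
by rewrite /almost_abelian_bracket u0 scale0r subr0 !raddf0 col_mx0.
Qed.

Lemma almost_abelian_bracket0x Y : almost_abelian_bracket A 0 Y = 0.
Proof.
have u0 : usubmx (0 : 'cV[R]_(1 + d)) 0 0 = 0 by rewrite !mxE.
by rewrite /almost_abelian_bracket u0 scale0r sub0r !raddf0 col_mx0.
Qed.

Lemma courant_covector (u : gtan R (1 + d)) (eta : 'rV[R]_(1 + d)) :
  courant (almost_abelian_bracket A) u (0, eta) =
  (0, coad (almost_abelian_bracket A) u.1 eta).
Proof.
congr pair; rewrite /=; first exact: almost_abelian_bracketx0.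
rewrite -[RHS]subr0; congr (_ - _); apply/rowP => j; rewrite [LHS]mxE [RHS]mxE.
by rewrite almost_abelian_bracket0x mulmx0 mxE oppr0.
Qed.

(** On h the bracket with X = a e_0 + v is a A, whatever v is. *)
Lemma rsubmx_coad (X : 'cV[R]_(1 + d)) (eta : 'rV[R]_(1 + d)) :
  rsubmx (coad (almost_abelian_bracket A) X eta) =
  - (usubmx X 0 0 *: (rsubmx eta *m A)).
Proof.
apply/rowP => j; rewrite mxE [LHS]mxE [RHS]mxE; congr (- _).
rewrite [RHS]mxE /almost_abelian_bracket.
have -> : usubmx (delta_mx (rshift 1 j) 0 : 'cV[R]_(1 + d)) 0 0 = 0.
  by rewrite !mxE.
have -> : dsubmx (delta_mx (rshift 1 j) 0 : 'cV[R]_(1 + d)) = delta_mx j 0.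
  by apply/colP => i; rewrite !mxE eq_rshift.
rewrite scale0r subr0 -[eta in LHS]hsubmxK mul_row_col mulmx0 add0r mulmxA.
by rewrite -scalemxAr -colE !mxE.
Qed.

(** If xi = a + i b and its conjugate both lie in L, then J a is both - b and b, so
    b = 0, and a = J b = 0. *)
Lemma eigen_covectors_conj :
  (Theta :&: map_mx conjc Theta)%MS = 0.
Proof.
apply/eqP; rewrite -submx0; apply/rV_subP => xi; rewrite sub_capmx => /andP[].
move=> /eigen_covectorsP/i_eigenspaceP[JRe JIm].
have xiK : map_mx conjc (map_mx conjc xi) = xi.
  by apply/rowP => j; rewrite !mxE conjcK.
rewrite -{1}xiK map_submx => /eigen_covectorsP/i_eigenspaceP[JRe' JIm'].
have ReE : gRe (0, map_mx conjc xi) = gRe (0, xi).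
  by congr pair; apply/rowP => j; rewrite !mxE; case: (xi 0 j).
have ImE : gIm (0, map_mx conjc xi) = - gIm (0, xi).
  congr pair; first by rewrite /= raddf0 oppr0.
  by apply/rowP => j; rewrite !mxE; case: (xi 0 j).
have Im0 : gIm (0, xi) = 0.
  move: JRe'; rewrite ReE JRe ImE => /eqP; rewrite eq_sym -subr_eq0 opprK.
  rewrite -mulr2n -scaler_nat scaler_eq0 pnatr_eq0 /=.
  by move=> /eqP.
have Re0 : gRe (0, xi) = 0 by rewrite -JIm Im0 linear0.
have := congr1 snd (gComplexK (0, xi)); rewrite Re0 Im0 /= => <-.
by rewrite submx0; apply/eqP/rowP => j; rewrite !mxE.
Qed.

(** Theta + conj Theta is direct, and restricting covectors to h costs it at most
    one dimension, that of the column of e_0. *)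
Lemma rank_eigen_covectors :
  (\rank Theta <= \rank U)%N /\ (overlap conjc U <= 1)%N.
Proof.
have Theta2 : \rank (col_mx Theta (map_mx conjc Theta)) = (\rank Theta).*2.
  rewrite -addsmxE -(rank_addsmx_conj conjc) /overlap eigen_covectors_conj.
  by rewrite mxrank0 addn0.
have := rank_le_rsubmx (col_mx Theta (map_mx conjc Theta)).
rewrite Theta2 rsubmx_col_mx -map_rsubmx -addsmxE.
have := rank_addsmx_conj conjc U.
have : (\rank U <= \rank Theta)%N.
  suff -> : U = Theta *m rsubmx 1%:M by apply: mxrankM_maxl.
  by rewrite mulmx_rsub mulmx1.
by move: (overlap _ _) (\rank (_ + _)%MS) (\rank U) (\rank Theta); lia.
Qed.

(** The element e_0 - i J e_0 of L has e_0-component 1 - i y with y real, hence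
    nonzero; bracketing it with a covector of Theta stays in Theta. *)
Lemma rsubmx_eigen_covectors_stable : (U *m AC <= U)%MS.
Proof.
have [JJ _ closed] := gcJ.
pose u : gtan R (1 + d) := (col_mx 1 0, 0).
pose y := usubmx (J u).1 0 0.
have uX : usubmx u.1 0 0 = 1 by rewrite /u /= col_mxKu mxE.
have Lw : i_eigenspace J (gComplex u (- J u)).
  apply/i_eigenspaceP; rewrite gRe_Complex gIm_Complex opprK; split=> //.
  have JN v : J (- v) = - J v by apply: raddfN.
  by rewrite JN JJ opprK.
apply/row_subP => i; rewrite row_mul.
set xi := row i Theta.
have rxi : row i U = rsubmx xi by apply/rowP => j; rewrite !mxE.
have Lxi : i_eigenspace J (0, xi) by apply/eigen_covectorsP/row_sub.
have := closed _ _ Lw Lxi.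
set a := (gRe (0, xi)).2; set b := (gIm (0, xi)).2.
have zRe : gRe (0, xi) = (0, a) by congr pair; rewrite /= raddf0.
have zIm : gIm (0, xi) = (0, b) by congr pair; rewrite /= raddf0.
have xiE : xi = map2_mx (@Complex R) a b.
  exact: esym (congr1 snd (gComplexK (0, xi))).
rewrite /cbilin gRe_Complex gIm_Complex zRe zIm !courant_covector.
set q := gComplex _ _.
have -> : q = (0, q.2).
  by rewrite /q; congr pair; apply/matrixP => l j; rewrite !mxE ?subrr ?addr0.
move/eigen_covectorsP => /submxP[D qE].
have c_neq0 : - (1 -i* y) != 0 by rewrite oppr_eq0 eq_complex /= oner_eq0.
have -> : row i U *m AC = (- (1 -i* y))^-1 *: rsubmx q.2.
  apply: (canRL (scalerK c_neq0)); rewrite rxi {1}xiE -map2_rsubmx map2_ComplexE.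
  rewrite mulmxDl -scalemxAl -!map_mxM /q /= -map2_rsubmx !raddfB /= !raddfD /=.
  rewrite !rsubmx_coad uX scale1r !raddfN /= [(- usubmx _) 0 0]mxE -/y.
  move: (rsubmx a *m A) (rsubmx b *m A) => p r.
  apply/rowP => j; rewrite !mxE; apply/eqP; rewrite eq_complex /=.
  by apply/andP; split; apply/eqP; ring.
by rewrite scalemx_sub // qE -mulmx_rsub submxMl.
Qed.

Lemma type_le_rank k : has_type J k -> (k <= \rank Theta)%N.
Proof.
case=> rho [[_ rhoL]] [B] [omega] [Omega].
move=> [B2 omega2 [c [theta [_ thetaF OmegaE]]] rhoE _].
have BC2 : homogeneous 2 (cform B omega).
  by move=> S /[dup] /B2 BS /omega2 oS; rewrite ffunE BS oS.
rewrite -(eqP thetaF) mxrankS //; apply/row_subP => i.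
apply/eigen_covectorsP/rhoL; rewrite /clifford contract0 add0r rhoE OmegaE.
by rewrite form1_wedge_spinor // pnatr_eq0.
Qed.

End AlmostAbelianType.

Theorem theorem4 (R : realType) (n : nat) (n_gt0 : (0 < n)%N)
    (A : 'M[R]_(2 * n - 1)) :
  ((forall z : R[i],
      eigenvalue (map_mx (real_complex R) A)^T z -> complex.Im z = 0) ->
   (forall lam : R,
      eigenvalue A^T lam -> \rank (eigenspace A^T lam) = 1%N) ->
   forall (J : {linear gtan R (1 + (2 * n - 1)) -> gtan R (1 + (2 * n - 1))})
     (k : nat),
     generalized_complex (almost_abelian_bracket A) J ->
     has_type J k -> (k <= 1)%N)
  /\
  (forall m : R -> seq nat,
   (forall lam : R, eigenvalue A^T lam -> jordan_sizes A lam (m lam)) ->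
   forall (J : {linear gtan R (1 + (2 * n - 1)) -> gtan R (1 + (2 * n - 1))})
     (k : nat),
     generalized_complex (almost_abelian_bracket A) J ->
     has_type J k ->
     forall lam : R, eigenvalue A^T lam ->
       (k <= (\sum_(1 <= j < (size (m lam))./2.+1) nth 0 (m lam) (2 * j).-1)
             + (2 * n - 1 - sumn (m lam))./2 + 1)%N).
Proof.
split=> [spec geom J k gcJ kJ|m mJ J k gcJ kJ lam lamA].
  have [Theta_le ov1] := rank_eigen_covectors J.
  apply: leq_trans (type_le_rank kJ) (leq_trans Theta_le (leq_trans _ ov1)).
  have UA := rsubmx_eigen_covectors_stable gcJ.
  exact: rank_invariant_real_nonderogatory UA spec geom.
have [Theta_le ov1] := rank_eigen_covectors J.
apply: leq_trans (type_le_rank kJ) (leq_trans Theta_le _).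
have UA := rsubmx_eigen_covectors_stable gcJ.
apply: leq_trans (rank_invariant_jordan UA (mJ _ lamA)) _.
by rewrite addnC leq_add2l.
Qed.
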